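(* Let $(X,\mathcal{G}|_\Lambda)$ be a switched system, let $Q$ be a nondegenerate subset of $X$, and let $K$ be a perfect compact subset of $X$. Then, for each $t\in\{1,2\}$, the set $K$ is weakly mixing of type $t$ with respect to $Q$ if and only if there exists an $F_\sigma$ set $C\subset K$ which is dense in $K$ and Xiong chaotic of type $t$ with respect to $Q$.
   Context: Switched system: $X$ is a metric space with metric $d$ (not necessarily compact), $\mathcal{I}=\{0,1,\ldots\}$ is a countable (finite or infinite) index set, $\mathcal{G}=\{f_i\}_{i\in\mathcal{I}}$ is a countable family of continuous self-maps of $X$, and $\Lambda$ is a subset of the set $\mathcal{I}^{\mathbb{N}}$ of all infinite sequences $x_0x_1x_2\cdots$ of elements of $\mathcal{I}$. The system $x_{n+1}=f_{\omega_n}(x_n)$ with switching sequences $\omega$ restricted to $\Lambda$ is denoted $(X,\mathcal{G}|_\Lambda)$. Words: $\mathcal{L}^n(\Lambda)$ ($n\ge 1$) is the set of words $x_0x_1\cdots x_{n-1}$ of length $n$ that are initial segments of some $x\in\Lambda$; $\mathcal{L}(\Lambda)=\bigcup_{n\ge1}\mathcal{L}^n(\Lambda)$; $l(u)$ is the length of the word $u$. For $\omega=\omega_0\cdots\omega_{n-1}\in\mathcal{L}^n(\Lambda)$ put $f_\omega=f_{\omega_{n-1}}\circ\cdots\circ f_{\omega_0}$. Hitting sets: for $A,V\subset X$, $N_1(A,V)=\{n\in\mathbb{N}:\exists\,\omega\in\mathcal{L}^n(\Lambda)\text{ with } f_\omega(A)\cap V\ne\emptyset\}$ and $N_2(A,V)=\{\omega\in\mathcal{L}(\Lambda):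 f_\omega(A)\cap V\neq\emptyset\}$. Weak mixing: let $K,Q\subset X$ and $n\ge2$. $K$ is weakly mixing of type 1 (resp. type 2) with respect to $Q$ of order $n$ if for all non-empty open subsets $U_1,\ldots,U_n,V_1,\ldots,V_n$ of $X$ with $U_i\cap K\ne\emptyset$ and $V_i\cap Q\neq\emptyset$ for $i=1,\dots,n$, there is an infinite increasing sequence $S=\{q_j\}$ in $\mathbb{N}$ with $S\subset N_1(K\cap U_i,V_i)$ for all $i=1,\dots,n$ (resp. an infinite sequence $S=\{s_j\}$ in $\mathcal{L}(\Lambda)$ with lengths $l(s_j)$ strictly increasing and $S\subset N_2(K\cap U_i,V_i)$ for all $i=1,\dots,n$). $K$ is weakly mixing of type $t$ with respect to $Q$ if it is so of order $n$ for every $n\ge2$. Xiong chaos: let $C,Q\subset X$. $C$ is Xiong chaotic of type 1 with respect to $Q$ if for every subset $E\subset C$ and every continuous map $g:E\to Q$ there is an increasing unbounded sequence $\{q_i\}$ in $\mathbb{N}$ such that for every $x\in E$ there are words $w^x_{q_i}\in\mathcal{L}^{q_i}(\Lambda)$ with $\lim_{i\to\infty}f_{w^x_{q_i}}(x)=g(x)$. $C$ is Xiong chaotic of type 2 with respect to $Q$ if for every $E\subset C$ and every continuous $g:E\to Q$ there are an increasing unbounded sequence $\{q_i\}$ of positive integers and words $\omega_{q_i}\in\mathcal{L}^{q_i}(\Lambda)$ such that $\lim_{i\to\infty}f_{\omega_{q_i}}(x)=g(x)$ for every $x\in E$. A set is nondegenerate if it has more than one point; a perfect set is a non-empty closed set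 with no isolated point. *)

(* Defs.v *)
From mathcomp Require Import all_boot all_order all_algebra.
From mathcomp Require Import all_classical all_reals all_analysis borel_hierarchy.
Set Implicit Arguments.
Unset Strict Implicit.
Unset Printing Implicit Defensive.

Local Open Scope classical_set_scope.

(* f_w = f_{w_(n-1)} \o ... \o f_{w_0}: the leftmost letter acts first. *)
Definition word_map (I X : Type) (f : I -> X -> X) (w : seq I) (x : X) : X :=
  foldl (fun y i => f i y) x w.

(* L^n(Lam); only meant for n >= 1, which the definitions below enforce. *)
Definition words_of_length (I : Type) (Lam : set (nat -> I)) (n : nat) :
    set (seq I) :=
  [set mkseq x n | x in Lam].

Definition language (I : Type) (Lam : set (nat -> I)) : set (seq I) :=
  \bigcup_(n in [set n | (1 <= n)%N]) words_of_length Lam n.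

Definition hitting1 (I X : Type) (f : I -> X -> X) (Lam : set (nat -> I))
    (A V : set X) : set nat :=
  [set n | (1 <= n)%N /\ exists2 w, words_of_length Lam n w &
                           (word_map f w @` A) `&` V !=set0].

Definition hitting2 (I X : Type) (f : I -> X -> X) (Lam : set (nat -> I))
    (A V : set X) : set (seq I) :=
  [set w | language Lam w /\ (word_map f w @` A) `&` V !=set0].

Definition weakly_mixing_order1 (I : Type) (X : topologicalType)
    (f : I -> X -> X) (Lam : set (nat -> I)) (K Q : set X) (n : nat) : Prop :=
  forall U V : 'I_n -> set X,
    (forall i, open (U i) /\ open (V i)) ->
    (forall i, U i `&` K !=set0 /\ V i `&` Q !=set0) ->
    exists q : nat -> nat, {homo q : i j / (i < j)%N} /\
      forall i, range q `<=` hitting1 f Lam (K `&` U i) (V i).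

Definition weakly_mixing_order2 (I : Type) (X : topologicalType)
    (f : I -> X -> X) (Lam : set (nat -> I)) (K Q : set X) (n : nat) : Prop :=
  forall U V : 'I_n -> set X,
    (forall i, open (U i) /\ open (V i)) ->
    (forall i, U i `&` K !=set0 /\ V i `&` Q !=set0) ->
    exists s : nat -> seq I, {homo size \o s : i j / (i < j)%N} /\
      forall i, range s `<=` hitting2 f Lam (K `&` U i) (V i).

Definition weakly_mixing1 (I : Type) (X : topologicalType)
    (f : I -> X -> X) (Lam : set (nat -> I)) (K Q : set X) : Prop :=
  forall n, (2 <= n)%N -> weakly_mixing_order1 f Lam K Q n.

Definition weakly_mixing2 (I : Type) (X : topologicalType)
    (f : I -> X -> X) (Lam : set (nat -> I)) (K Q : set X) : Prop :=
  forall n, (2 <= n)%N -> weakly_mixing_order2 f Lam K Q n.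

(* A continuous map E -> Q is given by a total g : X -> X whose restriction to
   E is continuous for the subspace topology and has values in Q; the values
   of g outside E are irrelevant. A strictly increasing q is unbounded. *)
Definition Xiong_chaotic1 (I : Type) (X : topologicalType)
    (f : I -> X -> X) (Lam : set (nat -> I)) (C Q : set X) : Prop :=
  forall (E : set X) (g : X -> X), E `<=` C ->
    {within E, continuous g} -> g @` E `<=` Q ->
    exists q : nat -> nat,
      [/\ {homo q : i j / (i < j)%N}, forall i, (1 <= q i)%N &
        forall x, E x -> exists w : nat -> seq I,
          (forall i, words_of_length Lam (q i) (w i)) /\
          word_map f (w i) x @[i --> \oo] --> g x].

Definition Xiong_chaotic2 (I : Type) (X : topologicalType)
    (f : I -> X -> X) (Lam : set (nat -> I)) (C Q : set X) : Prop :=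
  forall (E : set X) (g : X -> X), E `<=` C ->
    {within E, continuous g} -> g @` E `<=` Q ->
    exists (q : nat -> nat) (w : nat -> seq I),
      [/\ {homo q : i j / (i < j)%N}, forall i, (1 <= q i)%N,
        forall i, words_of_length Lam (q i) (w i) &
        forall x, E x -> word_map f (w i) x @[i --> \oo] --> g x].

Definition nondegenerate_set (X : Type) (A : set X) : Prop :=
  exists a b, [/\ A a, A b & a <> b].

(* Main.v *)
Require Import Defs.
From mathcomp Require Import all_boot all_order all_algebra.
From mathcomp Require Import all_classical all_reals all_analysis borel_hierarchy.
Set Implicit Arguments.
Unset Strict Implicit.
Unset Printing Implicit Defensive.
Import Order.TTheory GRing.Theory Num.Theory.
Local Open Scope classical_set_scope.

(** Words of one length may be chosen separately for each point (type 1) or be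
    one common word (type 2). Both types are treated at once, with a boolean
    selecting the common word (predicate [admissible]).

    Mixing yields chaos. A countable [C] is enough: it is the range of a
    sequence [c] of points of [K]. Let [V] be a countable family of open sets
    that contains arbitrarily small neighbourhoods of each point of [Q]. By weak
    mixing, for each finite list [V_0, ..., V_(n-1)] of members of [V] meeting
    [Q], and each bound [N], any open boxes [B_0, ..., B_(n-1)] meeting [K] can
    be shrunk so that words of one length at least [N] carry [B_i] into [V_i]
    for all [i < n]. These are countably many conditions, so a Baire
    category argument on sequences ([generic_family]) gives a sequence [c]
    satisfying all of them, with the points of [c] in prescribed open sets that
    make it dense in [K] ([weakly_mixing_generic_sequence]). Given [E] and [g],
    stage [n] concerns the first [n + 2] points of [c]: for those that are in
    [E], take as [V_i] a neighbourhood of [g (c i)] of size about [1 / n]. As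
    [n] grows, the resulting words send every point of [E] towards its image
    by [g] ([weakly_mixing_Xiong_chaotic]).

    The family [V] comes from a countable dense family [d] of [K]: weak mixing
    places [Q] in the closure of the countable set of all the points
    [word_map f w (d t)] ([weakly_mixing_orbit_dense]), and balls around these
    points are used.

    Chaos yields mixing. As [K] has no isolated point and [C] is dense in it,
    each [U_i] contains a point [p_i] of [C] with the [p_i] pairwise distinct
    ([perfect_distinct_points]). Every map on the finite set of the [p_i] is
    continuous, so [g] may send [p_i] to a chosen point of [V_i] and [Q], and
    the words given by chaos eventually carry each [p_i] into [V_i]. *)

(** * Baire category for sequences of points of a compact set *)

Lemma compact_nested_inter (X : topologicalType) (K : set X)
    (A : nat -> set X) : compact K ->
  (forall n, A n `&` K !=set0) -> (forall n, closure (A n.+1) `<=` A n) ->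
  exists2 x, K x & forall n, A n x.
Proof.
move=> cK AK Acl.
have Adec m n : (m <= n)%N -> A n `<=` A m.
  move=> /subnK <-; elim: (n - m)%N => [//|k IH].
  by rewrite addSn; apply: subset_trans IH => x /subset_closure; exact: Acl.
pose F := filter_from [set: nat] (fun n => A n `&` K).
have FF : ProperFilter F.
  apply: filter_from_proper => [|n _]; last exact: AK.
  apply: filter_from_filter; first by exists 0%N.
  move=> m n _ _; exists (maxn m n) => // x [Ax Kx].
  by split; split => //; apply: Adec Ax; rewrite (leq_maxl, leq_maxr).
have [|x [Kx clx]] := cK F FF; first by exists 0%N => // x [].
exists x => // n; apply: Acl => B Bx.
by have [|y [[Ay _] By]] := clx (A n.+1 `&` K) B _ Bx; [exists n.+1 | exists y].
Qed.

(** A Baire category argument in the product of copies of [K] indexed by [J],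
    with boxes [B] of open sets as basic open sets: refine the box once for
    each of the countably many conditions, its closures being nested, and let
    compactness of [K] choose a point in each coordinate. *)
Lemma generic_family (X : topologicalType) (J : Type) (T : countType)
    (K : set X) (U : J -> set X) (P : T -> (J -> X) -> Prop) :
  regular_space X -> compact K ->
  (forall j, open (U j) /\ U j `&` K !=set0) ->
  (forall t (B : J -> set X), (forall j, open (B j) /\ B j `&` K !=set0) ->
    exists B' : J -> set X,
      (forall j, [/\ open (B' j), B' j `&` K !=set0 & B' j `<=` B j]) /\
      forall c : J -> X, (forall j, B' j (c j)) -> P t c) ->
  exists c : J -> X, (forall j, K (c j) /\ U j (c j)) /\ forall t, P t c.
Proof.
move=> regX cK U_ok refine.
pose box := {B : J -> set X | forall j, open (B j) /\ B j `&` K !=set0}.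
have step (nB : nat * box) : exists B' : box,
    (forall j, closure (sval B' j) `<=` sval nB.2 j) /\
    forall t, unpickle nB.1 = Some t ->
      forall c : J -> X, (forall j, sval B' j (c j)) -> P t c.
  case: nB => n [B B_ok] /=.
  (* Step [n] deals with the condition coded by [n], if there is one. *)
  have [B1 [B1_ok B1P]] : exists B1 : J -> set X,
      (forall j, [/\ open (B1 j), B1 j `&` K !=set0 & B1 j `<=` B j]) /\
      forall t, unpickle n = Some t ->
        forall c : J -> X, (forall j, B1 j (c j)) -> P t c.
    case: (unpickle n) => [t|]; last first.
      by exists B; split=> [j|//]; by have [? ?] := B_ok j; split.
    have [B1 [? B1P]] := refine t B B_ok.
    by exists B1; split => // _ [<-].
  have shrink j : exists W : set X,
      [/\ open W, W `&` K !=set0 & closure W `<=` B1 j].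
    have [B1o [x [B1x Kx]] _] := B1_ok j.
    have [W xW clW] :=
      regX _ _ (open_nbhs_nbhs (conj B1o B1x)).
    exists (interior W); split; [exact: open_interior| by exists x |].
    by apply: subset_trans clW; apply: closureS; exact: interior_subset.
  have [B2 B2P] := choice shrink.
  have B2_ok j : open (B2 j) /\ B2 j `&` K !=set0 by have [] := B2P j.
  exists (exist _ B2 B2_ok) => /=; split=> [j x|t nt c cB2].
    by have [_ _ clB2] := B2P j; have [_ _ B1B] := B1_ok j => /clB2/B1B.
  apply: B1P nt _ _ => j; have [_ _ clB2] := B2P j.
  by apply/clB2/subset_closure/cB2.
have [next nextP] := choice step.
pose S := fix S n : box :=
  if n is m.+1 then next (m, S m) else exist _ U U_ok.
have Scl j n : closure (sval (S n.+1) j) `<=` sval (S n) j.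
  by have [/(_ j)] := nextP (n, S n).
have pts j : exists x, K x /\ forall n, sval (S n) j x.
  have [|x Kx Sx] :=
      compact_nested_inter (A := fun n => sval (S n) j) cK _ (Scl j).
    by move=> n; have [] := svalP (S n) j.
  by exists x.
have [c cP] := choice pts.
exists c; split=> [j|t]; first by have [Kc /(_ 0%N)] := cP j.
have [_ /(_ t (pickleK t))] := nextP (pickle t, S (pickle t)); apply => j.
by have [_ /(_ (pickle t).+1)] := cP j.
Qed.

(** * Countable families of balls *)

Section countable_balls.
Context {R : realType} {X : metricType R}.
Implicit Type K : set X.

Lemma compact_finite_net K (e : R) : compact K -> (0 < e)%R ->
  exists2 s : seq X, [set` s] `<=` K & K `<=` \bigcup_(y in [set` s]) ball y e.
Proof.
(* Compactness in terms of near coverings, for the filter of tails of the finite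
   lists of points of [K] directed by inclusion: every point of [K] is covered
   by the balls around a sufficiently large list, hence so is [K]. *)
move=> /compact_near_coveringP cK e0.
pose above (s : seq X) := [set t : seq X | {subset s <= t}].
pose F := filter_from [set s : seq X | [set` s] `<=` K] above.
have FF : Filter F.
  apply: filter_from_filter; first by exists [::].
  move=> s1 s2 /= s1K s2K; exists (s1 ++ s2).
    by move=> x /=; rewrite mem_cat => /orP[/s1K|/s2K].
  by move=> t st; split=> x xs; apply: st; rewrite mem_cat xs ?orbT.
pose covered (t : seq X) x := (\bigcup_(y in [set` t]) ball y e) x.
have [x Kx|s sK sP] := cK _ F covered FF.
  exists (ball x e, above [:: x]) => /=.
    split; first exact: nbhsx_ballx.
    by exists [:: x] => // y /=; rewrite inE => /eqP ->.
  by case=> y t /= [xy xt]; exists x => //=; apply: xt; rewrite mem_head.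
by exists s => //; exact: sP.
Qed.

Lemma compact_dense_family K : compact K -> K !=set0 ->
  exists d : nat * nat -> X, (forall t, K (d t)) /\ K `<=` closure (range d).
Proof.
move=> cK [x0 Kx0].
have /choice[s sP] : forall n, exists s : seq X, [set` s] `<=` K /\
    K `<=` \bigcup_(y in [set` s]) ball y (n.+1%:R^-1 : R)%R.
  move=> n.
  have [|s ? ?] := @compact_finite_net K (n.+1%:R^-1)%R cK; last by exists s.
  by rewrite invr_gt0 ltr0n.
exists (fun t => nth x0 (s t.1) t.2); split=> [[n i] /=|x Kx B].
  have [si|si] := ltnP i (size (s n)); last by rewrite nth_default.
  by have [sK _] := sP n; apply: sK; exact: mem_nth.
move=> /nbhs_ballP[_/posnumP[e] eB].
have [N _ Ne] := near_infty_natSinv_lt e.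
have [_ /(_ x Kx)[y ys yx]] := sP N.
exists y; split; last first.
  by apply/eB/ball_sym/(le_ball (ltW (Ne N (leqnn N)))).
by exists (N, index y (s N)) => //=; rewrite nth_index.
Qed.

(** The interior is taken because balls are not open by definition. *)
Definition small_ball (T : Type) (d : T -> X) (k : T * nat) : set X :=
  interior (ball (d k.1) (k.2.+1%:R^-1 : R)%R).

Lemma small_ball_base (T : Type) (d : T -> X) z (e : R) :
  closure (range d) z -> (0 < e)%R ->
  exists k, small_ball d k z /\ small_ball d k `<=` ball z e.
Proof.
move=> dz e0; have e20 : (0 < e / 2)%R by rewrite divr_gt0.
have [N _ Ne] := near_infty_natSinv_lt (PosNum e20).
have N0 : (0 < N.+1%:R^-1 :> R)%R by rewrite invr_gt0 ltr0n.
have N20 : (0 < N.+1%:R^-1 / 2 :> R)%R by rewrite divr_gt0.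
have [_ [[t _ <-] zt]] := dz _ (nbhsx_ballx z _ N20).
have /= {}Ne := ltW (Ne N (leqnn N)).
(* The open neighbourhood [ball z (N.+1%:R^-1 / 2)] of [z] lies in the ball
   around [d t] of twice its radius. *)
exists (t, N); split=> [|y /interior_subset /= ty].
  apply: filterS (nbhsx_ballx z _ N20) => y zy /=.
  by rewrite [(_^-1)%R]splitr; apply: ball_triangle (ball_sym zt) zy.
rewrite [e]splitr; apply: (@ball_triangle _ _ (d t)).
  apply: le_ball zt; apply: le_trans Ne.
  by rewrite ler_pdivrMr// ler_peMr// ler1n.
exact: le_ball Ne _ ty.
Qed.

Lemma open_small_ball (T : Type) (d : T -> X) k : open (small_ball d k).
Proof. exact: open_interior. Qed.

End countable_balls.

(** * Finite sets and perfect sets *)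

Section perfect_sets.
Context {X : topologicalType} (X1 : accessible_space X).
Implicit Types K U : set X.

Let T1_closed (A : set X) : finite_set A -> closed A.
Proof. by move: A; exact/accessible_finite_set_closed. Qed.

(** Removing one point from an open set that meets [K] cannot empty its trace on
    [K], as this point is not isolated in [K]; iterate over [s]. *)
Lemma perfect_inter_avoid K U (s : seq X) : perfect_set K -> open U ->
  U `&` K !=set0 -> exists x, [/\ U x, K x & x \notin s].
Proof.
move=> [_ limK]; elim: s U => [|a s IH] U Uo [x [Ux Kx]]; first by exists x.
have Vo : open (U `\ a).
  rewrite setDE; apply: openI => //;
    exact: closed_openC (T1_closed (finite_set1 a)).
have [|y [[Uy ya] Ky ys]] := IH _ Vo; last first.
  by exists y; split=> //; rewrite inE negb_or ys andbT; apply/eqP.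
have [xa|xa] := pselect (x = a); last by exists x.
have [y [/eqP ya Ky Uy]] : exists y, [/\ y != x, K y & U y].
  by move: Kx; rewrite -{1}limK; apply; exact: open_nbhs_nbhs.
by exists y; split=> //; split=> //; rewrite -xa.
Qed.

(** The points are chosen one after the other. The open set left for a new point
    once the previous ones are removed still meets [K], hence [C]. *)
Lemma perfect_distinct_points K C (U : nat -> set X) n : perfect_set K ->
  K `<=` closure C ->
  (forall i, (i < n)%N -> open (U i) /\ U i `&` K !=set0) ->
  exists s : seq X, [/\ size s = n, uniq s &
    forall i x0, (i < n)%N -> C (nth x0 s i) /\ U i (nth x0 s i)].
Proof.
move=> pK CK; elim: n => [|n IH] U_ok; first by exists [::].
have [|s [sn us sCU]] := IH; first by move=> i /ltnW; exact: U_ok.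
have [Uo UK] := U_ok n (ltnSn n).
have Vo : open (U n `\` [set` s]).
  rewrite setDE; apply: openI => //;
    exact: closed_openC (T1_closed (finite_seq s)).
have [x [Ux Kx /negP xs]] := perfect_inter_avoid s pK Uo UK.
have [y [Cy [Uy /negP ys]]] :=
  CK x Kx _ (open_nbhs_nbhs (conj Vo (conj Ux xs))).
exists (rcons s y); split; rewrite ?size_rcons ?sn ?rcons_uniq ?ys// => i x0.
rewrite ltnS leq_eqVlt nth_rcons sn => /predU1P[->|lt_in].
  by rewrite ltnn eqxx.
by rewrite lt_in; exact: sCU.
Qed.

Lemma finite_within_continuous (Y : topologicalType) (s : seq X) (g : X -> Y) :
  {within [set` s], continuous g}.
Proof.
apply/subspace_continuousP => x xs.
have Vo : open (~` ([set` s] `\ x)).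
  apply: closed_openC; apply: T1_closed.
  by apply: sub_finite_set (finite_seq s) => y [].
have Vx : (~` ([set` s] `\ x)) x by case=> _; exact.
move=> W /nbhs_singleton Wgx.
apply: filterS (open_nbhs_nbhs (conj Vo Vx)) => y Vy ys.
by have [->//|yx] := pselect (y = x); case: Vy.
Qed.

End perfect_sets.

(** * A common form for both types *)

Lemma unbounded_subsequence (q : nat -> nat) : (forall n, n <= q n)%N ->
  exists phi : nat -> nat,
    (forall k, k <= phi k)%N /\ {homo q \o phi : i j / (i < j)%N}.
Proof.
move=> qP; pose phi := fix phi k := if k is k'.+1 then (q (phi k')).+1 else 0%N.
exists phi; split.
  by elim=> // k IH /=; rewrite ltnS (leq_trans IH) ?qP.
by apply: homo_ltn => [|k] /=; [exact: ltn_trans | rewrite qP].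
Qed.

Section switched_system.
Context {I : Type} {X : topologicalType}.
Context (f : I -> X -> X) (Lam : set (nat -> I)).

(** The boolean [b] is true when the points of [D] must share one word. The
    common word [w0] is required even when [D] is empty, as Xiong chaos of type
    2 provides words for the empty set too. *)
Definition admissible (b : bool) (n : nat) (T : Type) (D : set T)
    (w : T -> seq I) :=
  (forall t, D t -> words_of_length Lam n (w t)) /\
  (b -> exists2 w0, words_of_length Lam n w0 & forall t, D t -> w t = w0).

(** Families indexed by [nat] whose first [n] terms matter replace families
    indexed by ['I_n], so that orders [n] can vary without casts. *)
Definition weakly_mixing (b : bool) (K Q : set X) :=
  forall n (U V : nat -> set X), (2 <= n)%N ->
    (forall i, (i < n)%N -> [/\ open (U i), open (V i), U i `&` K !=set0
                              & V i `&` Q !=set0]) ->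
  exists (q : nat -> nat) (w : nat -> nat -> seq I),
    {homo q : i j / (i < j)%N} /\
    forall k, [/\ (1 <= q k)%N, admissible b (q k) `I_n (w k) &
      forall i, (i < n)%N ->
        exists2 x, (K `&` U i) x & V i (word_map f (w k i) x)].

Definition Xiong_chaotic (b : bool) (C Q : set X) :=
  forall (E : set X) (g : X -> X), E `<=` C ->
    {within E, continuous g} -> g @` E `<=` Q ->
  exists (q : nat -> nat) (w : nat -> X -> seq I),
    [/\ {homo q : i j / (i < j)%N},
      forall k, (1 <= q k)%N /\ admissible b (q k) E (w k) &
      forall x, E x -> word_map f (w k x) x @[k --> \oo] --> g x].

Lemma size_words_of_length n w : words_of_length Lam n w -> size w = n.
Proof. by case=> x _ <-; rewrite size_mkseq. Qed.

Lemma weakly_mixing1P K Q :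
  weakly_mixing1 f Lam K Q <-> weakly_mixing false K Q.
Proof.
split=> [wm n U V n2 UV_ok|wm n n2 U V oUV UV0].
  have [||q [qm qP]] := wm n n2 (fun i => U i) (fun i => V i).
  - by move=> i; have [] := UV_ok i (ltn_ord i).
  - by move=> i; have [] := UV_ok i (ltn_ord i).
  have /choice[w wP] (p : nat * nat) : exists w : seq I, (p.2 < n)%N ->
      words_of_length Lam (q p.1) w /\
      exists2 x, (K `&` U p.2) x & V p.2 (word_map f w x).
    case: p => k i /=; have [lt_in|] := ltnP i n; last by exists [::].
    have [_ [w wq [_ [[x KUx <-] Vx]]]] := qP (Ordinal lt_in) _ (imageT q k).
    by exists w => _; split=> //; exists x.
  exists q, (fun k i => w (k, i)); split=> // k; split.
  - by have [] := qP (Ordinal (ltnW n2)) _ (imageT q k).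
  - split=> // i lt_in; by have [] := wP (k, i) lt_in.
  - by move=> i lt_in; have [] := wP (k, i) lt_in.
have n0 := ltnW n2; pose o i : 'I_n := insubd (Ordinal n0) i.
have oE (i : 'I_n) : o i = i by rewrite /o /insubd valK.
have [|q [w [qm qP]]] := wm n (U \o o) (V \o o) n2.
  by move=> i _ /=; have [] := oUV (o i); have [] := UV0 (o i).
exists q; split=> // i _ [k _ <-].
have [q1 [wq _] wUV] := qP k; split=> //.
exists (w k i); first exact: wq (ltn_ord i).
have [x] := wUV i (ltn_ord i); rewrite /= oE => KUx Vx.
by exists (word_map f (w k i) x); split=> //; exists x.
Qed.

Lemma weakly_mixing2P K Q :
  weakly_mixing2 f Lam K Q <-> weakly_mixing true K Q.
Proof.
split=> [wm n U V n2 UV_ok|wm n n2 U V oUV UV0].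
  have [||s [sm sP]] := wm n n2 (fun i => U i) (fun i => V i).
  - by move=> i; have [] := UV_ok i (ltn_ord i).
  - by move=> i; have [] := UV_ok i (ltn_ord i).
  have words k : (1 <= size (s k))%N /\ words_of_length Lam (size (s k)) (s k).
    have [[m m1 sm_] _] := sP (Ordinal (ltnW n2)) _ (imageT s k).
    by rewrite (size_words_of_length sm_).
  exists (size \o s), (fun k _ => s k); split=> // k.
  have [s1 sw] := words k; split=> //; first by split=> [//|_]; exists (s k).
  move=> i lt_in.
  have [_ [_ [[x KUx <-] Vx]]] := sP (Ordinal lt_in) _ (imageT s k).
  by exists x.
have n0 := ltnW n2; pose o i : 'I_n := insubd (Ordinal n0) i.
have oE (i : 'I_n) : o i = i by rewrite /o /insubd valK.
have [|q [w [qm qP]]] := wm n (U \o o) (V \o o) n2.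
  by move=> i _ /=; have [] := oUV (o i); have [] := UV0 (o i).
have /choice[s sP] k : exists s, words_of_length Lam (q k) s /\
    forall i, (i < n)%N -> w k i = s.
  by have [_ [_ /(_ isT)[s ? ?]] _] := qP k; exists s.
have sizes k : size (s k) = q k by have [/size_words_of_length] := sP k.
exists s; split=> [i j ij|i _ [k _ <-]]; first by rewrite /= !sizes qm.
have [q1 _ wUV] := qP k; have [sw ws] := sP k; split; first by exists (q k).
have [x] := wUV i (ltn_ord i); rewrite /= oE ws// => KUx Vx.
by exists (word_map f (s k) x); split=> //; exists x.
Qed.

Lemma Xiong_chaotic1P C Q :
  Xiong_chaotic1 f Lam C Q <-> Xiong_chaotic false C Q.
Proof.
split=> ch E g EC gc gQ; last first.
  have [q [w [qm qw wg]]] := ch E g EC gc gQ.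
  exists q; split=> // [k|x Ex]; first by have [] := qw k.
  exists (w ^~ x); split; last exact: wg.
  by move=> k; have [_ [/(_ x Ex)]] := qw k.
have [q [qm q1 qP]] := ch E g EC gc gQ.
have /choice[w wP] x : exists w : nat -> seq I, E x ->
    (forall k, words_of_length Lam (q k) (w k)) /\
    word_map f (w k) x @[k --> \oo] --> g x.
  by have [/qP[w ?]|] := pselect (E x); [exists w | exists (fun=> [::])].
exists q, (fun k x => w x k); split=> // [k|x /wP[]//]; split=> //; split=> //.
by move=> x /wP[].
Qed.

Lemma Xiong_chaotic2P C Q : X ->
  Xiong_chaotic2 f Lam C Q <-> Xiong_chaotic true C Q.
Proof.
move=> x0; split=> ch E g EC gc gQ.
  have [q [w [qm q1 qw wg]]] := ch E g EC gc gQ.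
  exists q, (fun k _ => w k); split=> // k; split=> //; split=> // _.
  by exists (w k).
have [q [w [qm qw wg]]] := ch E g EC gc gQ.
have /choice[s sP] k : exists s, words_of_length Lam (q k) s /\
    forall x, E x -> w k x = s.
  by have [_ [_ /(_ isT)[s ? ?]]] := qw k; exists s.
exists q, s; split=> // [k|k|x Ex]; [by have [] := qw k | by have [] := sP k |].
have -> : (fun k => word_map f (s k) x) = (fun k => word_map f (w k x) x).
  by apply/funext => k; have [_ ->] := sP k.
exact: wg.
Qed.

Lemma continuous_word_map w : (forall i, continuous (f i)) ->
  continuous (word_map f w).
Proof.
move=> fc; elim: w => [|i w IH] x; first exact: cvg_id.
exact: (@continuous_comp _ _ _ (f i) (word_map f w) x (fc i x) (IH (f i x))).
Qed.
End switched_system.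

(** * Chaos implies mixing *)

Section mixing.
Context {X : topologicalType} {I : Type}.
Context (f : I -> X -> X) (Lam : set (nat -> I)).

(** Finitely many distinct points can be given arbitrary images by a continuous
    map, so they can be sent into the [V i] at common times. *)
Lemma Xiong_chaotic_weakly_mixing b K C Q : accessible_space X ->
  perfect_set K -> C `<=` K ->
  K `<=` closure C -> Xiong_chaotic f Lam b C Q -> weakly_mixing f Lam b K Q.
Proof.
move=> X1 pK CK Kcl ch n U V n2 UV_ok.
have [|s [sn us sCU]] := perfect_distinct_points (n := n) (U := U) X1 pK Kcl.
  by move=> i /UV_ok[].
have n0 := ltnW n2.
(* The default value [p0] belongs to [s], so every [p i] is in [s]. *)
have [p0 sE] : exists p0, s = p0 :: behead s.
  by case: (s) sn n0 => [<-//|p0 s' _ _]; exists p0.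
pose p := nth p0 s.
have sp i : p i \in s.
  have [?|?] := ltnP i (size s); first exact: mem_nth.
  by rewrite /p nth_default// sE mem_head.
have /choice[v vP] i : exists v, (i < n)%N -> V i v /\ Q v.
  have [/UV_ok[_ _ _ [v [? ?]]]|] := ltnP i n; first by exists v.
  by exists p0.
have sC : [set` s] `<=` C.
  move=> x /= xs; have [|+ _] := sCU (index x s) p0; last by rewrite nth_index.
  by rewrite -sn index_mem.
have vQ : (fun x => v (index x s)) @` [set` s] `<=` Q.
  by move=> _ [x /= xs <-]; have [|//] := vP (index x s); rewrite -sn index_mem.
have [q [w [qm qw wg]]] :=
  ch _ _ sC (@finite_within_continuous _ X1 _ s _) vQ.
have /filter_forall[N _ NP] (i : 'I_n) :
    \forall k \near \oo, V i (word_map f (w k (p i)) (p i)).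
  apply: (wg (p i) (sp i)); rewrite /= index_uniq ?sn//.
  have [_ Vo _ _] := UV_ok i (ltn_ord i); have [Vv _] := vP i (ltn_ord i).
  exact: open_nbhs_nbhs.
exists (fun k => q (N + k)%N), (fun k i => w (N + k)%N (p i)); split.
  by move=> i j ij; apply: qm; rewrite ltn_add2l.
move=> k; have [q1 [wq wb]] := qw (N + k)%N; split=> //.
  split=> [i _|/wb[w0 w0q ww0]]; first exact: wq (sp i).
  by exists w0 => // i _; exact: ww0 (sp i).
move=> i lt_in; have [Cp Up] := sCU i p0 lt_in.
exists (p i); first by split=> //; exact: CK.
exact: NP (leq_addr _ _) (Ordinal lt_in).
Qed.

(** * Mixing implies chaos *)

(** Applied with [U_i] the whole space, weak mixing moves points of [K], hence
    points of the dense family [d], close to any point of [Q]. *)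
Lemma weakly_mixing_orbit_dense b K Q (T : Type) (d : T -> X) :
  (forall i, continuous (f i)) ->
  weakly_mixing f Lam b K Q -> K !=set0 -> K `<=` closure (range d) ->
  Q `<=` closure (range (fun p : seq I * T => word_map f p.1 (d p.2))).
Proof.
move=> f_cont wm K0 Kd z Qz B zB.
have [|q [w [_ /(_ 0%N)[_ _ /(_ 0%N isT)[x [Kx _] Bx]]]]] :=
    wm 2 (fun=> setT) (fun=> interior B) isT.
  move=> i _; split; [exact: openT|exact: open_interior|by rewrite setTI|].
  by exists z.
have wx : nbhs x (word_map f (w 0%N 0%N) @^-1` B).
  by apply: continuous_word_map.
have [_ [[t _ <-] Bt]] := Kd x Kx _ wx.
by exists (word_map f (w 0%N 0%N) (d t)); split=> //; exists (w 0%N 0%N, t).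
Qed.

(** The condition imposed on a generic sequence [c]: its first [size s] points
    reach the targets listed in [s] simultaneously, with words of one length at
    least [N]. *)
Definition hits (b : bool) (T : Type) (V : T -> set X) (c : nat -> X) (N : nat)
    (s : seq T) :=
  exists q (w : nat -> seq I),
    [/\ (1 <= q)%N, (N <= q)%N, admissible Lam b q `I_(size s) w &
      forall i t0, (i < size s)%N -> V (nth t0 s i) (word_map f (w i) (c i))].

(** One shrinking of boxes is exactly one use of weak mixing, of order the
    number of targets. *)
Lemma weakly_mixing_generic_sequence b K Q (T : countType) (V : T -> set X)
    (U : nat -> set X) :
  regular_space X -> (forall i, continuous (f i)) ->
  compact K -> weakly_mixing f Lam b K Q ->
  (forall i, open (U i) /\ U i `&` K !=set0) -> (forall t, open (V t)) ->
  exists c : nat -> X, (forall i, K (c i) /\ U i (c i)) /\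
    forall N s, (2 <= size s)%N -> (forall t, t \in s -> V t `&` Q !=set0) ->
      hits b V c N s.
Proof.
move=> regX f_cont cK wm U_ok Vo.
have [|c [cKU cP]] := generic_family (T := (nat * seq T)%type) (U := U)
  (P := fun Ns c => (2 <= size Ns.2)%N ->
     (forall t, t \in Ns.2 -> V t `&` Q !=set0) -> hits b V c Ns.1 Ns.2)
  regX cK U_ok; last first.
  by exists c; split=> // N s; exact: cP (N, s).
case=> N s B B_ok /=.
have [[s2 VQ]|vacuous] :=
    pselect ((2 <= size s)%N /\ forall t, t \in s -> V t `&` Q !=set0);
  last first.
  exists B; split=> [j|c _ s2 VQ]; last by case: vacuous.
  by have [? ?] := B_ok j; split.
have [t0 sE] : exists t0, s = t0 :: behead s.
  by case: (s) s2 => // t0 s' _; exists t0.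
have [|q [w [qm /(_ N)[q1 wq wV]]]] :=
    wm (size s) B (fun i => V (nth t0 s i)) s2.
  move=> i si; have [Bo BK] := B_ok i; split=> //; exact/VQ/mem_nth.
have wo i : open (word_map f (w N i) @^-1` V (nth t0 s i)).
  by apply: open_comp (Vo _) => x _; exact: continuous_word_map.
pose B' i := if (i < size s)%N
  then B i `&` word_map f (w N i) @^-1` V (nth t0 s i) else B i.
exists B'; split.
  move=> i; have [Bo BK] := B_ok i.
  rewrite /B'; case: ifPn => [si|_]; last by split.
  split; [exact: openI | | exact: subIsetl].
  by have [x [Kx Bx] Vx] := wV i si; exists x.
move=> c cB' _ _; exists (q N), (w N); split=> //.
  by elim: (N) => // k IH; exact: leq_ltn_trans IH (qm _ _ (ltnSn k)).
move=> i t1 si; have := cB' i; rewrite /B' si (set_nth_default t0)//.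
by case.
Qed.

End mixing.

(** The set [C] is the range of a sequence [c] generic for the targets
    [small_ball y k], with [y] dense around [Q], where the points of [c] are
    confined to the members of a countable base of [K]. *)
Lemma weakly_mixing_Xiong_chaotic (R : realType) (X : metricType R)
    (I : countType) (f : I -> X -> X) (Lam : set (nat -> I)) b (K Q : set X) :
  (forall i, continuous (f i)) ->
  compact K -> K !=set0 -> Q !=set0 ->
  weakly_mixing f Lam b K Q ->
  exists C : set X,
    [/\ Fsigma C, C `<=` K, K `<=` closure C & Xiong_chaotic f Lam b C Q].
Proof.
move=> f_cont cK K0 [z0 Qz0] wm.
have [d [dK Kd]] := compact_dense_family cK K0.
have Qd := weakly_mixing_orbit_dense f_cont wm K0 Kd.
set y := (fun p => _) in Qd.
pose U j := if unpickle j is Some k then small_ball d k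
  else small_ball d ((0, 0), 0)%N.
have ballK k : open (small_ball d k) /\ small_ball d k `&` K !=set0.
  split; first exact: open_small_ball.
  exists (d k.1); split; last exact: dK.
  by apply: nbhsx_ballx; rewrite invr_gt0 ltr0n.
have U_ok j : open (U j) /\ U j `&` K !=set0 by rewrite /U; case: unpickle.
have [c [cKU cP]] := weakly_mixing_generic_sequence uniform_regular f_cont
  cK wm U_ok (open_small_ball y).
exists (range c); split.
- exists (fun i => [set c i]) => [i|].
    exact/accessible_closed_set1/hausdorff_accessible/metric_hausdorff.
  apply/seteqP; split=> [_ [i _ <-]|x [i _ ->]]; by exists i.
- by move=> _ [i _ <-]; have [] := cKU i.
- move=> x Kx B /nbhs_ballP[e /= e0 eB].
  have [k [_ kB]] := small_ball_base (Kd x Kx) e0.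
  exists (c (pickle k)); split; first by exists (pickle k).
  by apply/eB/kB; have [_] := cKU (pickle k); rewrite /U pickleK.
move=> E g EC _ gQ.
have /choice[idx idxP] x : exists i, E x -> c i = x.
  by have [/EC[i _ <-]|] := pselect (E x); [exists i | exists 0%N].
(* For each accuracy [p.1] and each index [p.2], a target for [c p.2]. *)
have /choice[a aP] (p : nat * nat) : exists k, small_ball y k `&` Q !=set0 /\
    (E (c p.2) -> small_ball y k `<=` ball (g (c p.2)) (p.1.+1%:R^-1 : R)%R).
  have N0 : (0 < p.1.+1%:R^-1 :> R)%R by rewrite invr_gt0 ltr0n.
  have [Ec|nEc] := pselect (E (c p.2)).
    have Qg : Q (g (c p.2)) by apply: gQ; exists (c p.2).
    have [k [kg kB]] := small_ball_base (Qd _ Qg) N0.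
    by exists k; split=> //; exists (g (c p.2)).
  have [k [kz _]] := small_ball_base (Qd _ Qz0) N0.
  by exists k; split=> //; exists z0.
have /choice[qw qwP] n : exists qw : nat * (nat -> seq I),
    [/\ (1 <= qw.1)%N, (n <= qw.1)%N, admissible Lam b qw.1 `I_n.+2 qw.2 &
    forall i, (i < n.+2)%N -> E (c i) ->
      ball (g (c i)) (n.+1%:R^-1 : R)%R (word_map f (qw.2 i) (c i))].
  have [||q [w [q1 nq wq wV]]] := cP n (mkseq (fun i => a (n, i)) n.+2).
  - by rewrite size_mkseq.
  - by move=> _ /mapP[i _ ->]; have [] := aP (n, i).
  exists (q, w); split=> //=; first by move: wq; rewrite size_mkseq.
  move=> i lt_in Ec; have [_ /(_ Ec)] := aP (n, i); apply.
  by have := wV i (a (n, i)); rewrite size_mkseq nth_mkseq//; exact.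
(* Stage [n] gives words of length at least [n]; a subsequence makes the
   lengths strictly increasing. *)
have [|phi [phi_ge phi_mono]] := unbounded_subsequence (q := fun n => (qw n).1).
  by move=> n; have [] := qwP n.
(* The words of stage [n] are admissible for indices below [n.+2] only; the
   truncation by [minn] makes them admissible for every point of [E] and, for
   a given point, no longer acts from some stage on. *)
exists (fun k => (qw (phi k)).1),
  (fun k x => (qw (phi k)).2 (minn (idx x) (phi k).+1)).
split=> // [k|x Ex].
  have [q1 _ [wq wb] _] := qwP (phi k); split=> //.
  have ltk x : (minn (idx x) (phi k).+1 < (phi k).+2)%N.
    by rewrite ltnS geq_minr.
  split=> [x _|/wb[w0 w0q ww0]]; first exact: wq (ltk x).
  by exists w0 => // x _; exact: ww0 (ltk x).
apply/cvg_ballP => e e0.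
have cx := idxP x Ex.
have [N _ Ne] := near_infty_natSinv_lt (PosNum e0).
exists (maxn N (idx x)) => // k /=; rewrite geq_max => /andP[Nk xk].
have xphi : (idx x <= phi k)%N := leq_trans xk (phi_ge k).
rewrite (minn_idPl (leqW xphi)).
have [_ _ _ /(_ (idx x))] := qwP (phi k); rewrite cx => /(_ _ Ex) wx.
apply: le_ball (ltW (Ne (phi k) (leq_trans Nk (phi_ge k)))) _ _.
by apply: wx; rewrite ltnS leqW.
Qed.

(** * The characterization *)

Unset Implicit Arguments.

Theorem theorem1 (R : realType) (X : metricType R) (I : countType)
    (f : I -> X -> X) (f_cont : forall i, continuous (f i))
    (Lam : set (nat -> I)) (Q K : set X)
    (Q_nondegenerate : nondegenerate_set Q)
    (K_nonempty : K !=set0) (K_perfect : perfect_set K)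
    (K_compact : compact K) :
  (weakly_mixing1 f Lam K Q <->
     exists C : set X,
       [/\ Fsigma C, C `<=` K, K `<=` closure C & Xiong_chaotic1 f Lam C Q]) /\
  (weakly_mixing2 f Lam K Q <->
     exists C : set X,
       [/\ Fsigma C, C `<=` K, K `<=` closure C & Xiong_chaotic2 f Lam C Q]).
Proof.
have [z [_ [Qz _ _]]] := Q_nondegenerate.
have Q0 : Q !=set0 by exists z.
have X1 : accessible_space X := hausdorff_accessible (@metric_hausdorff R X).
have wm_chaos b := @weakly_mixing_Xiong_chaotic R X I f Lam b K Q
  f_cont K_compact K_nonempty Q0.
split; split.
- move=> /weakly_mixing1P/wm_chaos[C [CF CK KC ch]].
  by exists C; split=> //; apply/Xiong_chaotic1P.
- case=> C [_ CK KC /Xiong_chaotic1P ch]; apply/weakly_mixing1P.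
  exact: Xiong_chaotic_weakly_mixing ch.
- move=> /weakly_mixing2P/wm_chaos[C [CF CK KC ch]].
  by exists C; split=> //; apply/(Xiong_chaotic2P _ _ _ _ z).
- case=> C [_ CK KC /(Xiong_chaotic2P _ _ _ _ z) ch]; apply/weakly_mixing2P.
  exact: Xiong_chaotic_weakly_mixing ch.
Qed.
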